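(* Let $p>5$ be a prime. There is no subgroup $H$ of $\mathbb{F}_p^\times$ and no element $g\in\mathbb{F}_p^\times$ such that the set $A:=gH\cup\{0\}$ (where $gH=\{gh\colon h\in H\}$) satisfies $A-A\doteq\mathcal{R}_p$.
   Context: $\mathcal{R}_p\subseteq\mathbb{F}_p$ denotes the set of nonzero quadratic residues modulo $p$. For subsets $A,S$ of an abelian group, $A-A\doteq S$ means: every element of $S$ has exactly one representation as $a'-a''$ with $a',a''\in A$, and every difference $a'-a''$ with $a',a''\in A$, $a'\ne a''$, belongs to $S$. *)

(* Defs.v *)
From HB Require Import structures.
From mathcomp Require Import all_boot all_order all_algebra all_fingroup.
Set Implicit Arguments. Unset Strict Implicit. Unset Printing Implicit Defensive.
Import GRing.Theory.
Local Open Scope ring_scope.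

Definition diff_exact (G : finZmodType) (A S : {set G}) : Prop :=
  (forall s, s \in S ->
     exists! pr : G * G, [/\ pr.1 \in A, pr.2 \in A & pr.1 - pr.2 = s])
  /\ (forall a1 a2, a1 \in A -> a2 \in A -> a1 != a2 -> a1 - a2 \in S).

Definition quad_res (p : nat) : {set 'F_p} :=
  [set x : 'F_p | (x != 0) && [exists y : 'F_p, y ^+ 2 == x]].

Definition cosetA (p : nat) (g : {unit 'F_p}) (H : {set {unit 'F_p}}) : {set 'F_p} :=
  0 |: [set val (g * h)%g | h in H].

(* Main.v *)
(** Put n = #|H|.  Counting differences gives (p-1)/2 = n(n+1), so that
    2n^2 + 2n + 1 = 0 in F_p.  The elements of A = gH u {0} are the roots of
    P = X^(n+1) - g^n X, hence the product of all differences of distinct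
    elements of A is the product of P'(a) over A, that is, - n^n; being also
    the product of all quadratic residues, it is -1.  Thus n^n = 1 in F_p, so
    that n lies in H.  As 2n^3 - n - 1 = (n - 1)(2n^2 + 2n + 1) = 0, the
    residue g n^3 - g = g n - g n^3 is represented twice. *)
Require Import Defs.
From HB Require Import structures.
From mathcomp Require Import all_boot all_order all_algebra all_fingroup.
From mathcomp Require Import cyclic finfield ring.
Import GRing.Theory.
Local Open Scope ring_scope.

Lemma cubic_factor (R : comNzRingType) (x : R) :
  2 * x ^+ 3 - (x + 1) = (x - 1) * (2 * x * (x + 1) + 1).
Proof. by ring. Qed.

(** [#|A|] distinct roots exhaust the degree of [P], and being monic fixes the leading constant. *)
Lemma monic_prod_roots (F : finFieldType) (A : {set F}) (P : {poly F}) :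
  P \is monic -> size P = #|A|.+1 -> {in A, forall a, root P a} ->
  P = \prod_(a in A) ('X - a%:P).
Proof.
move=> monP szP rP.
rewrite [LHS](@all_roots_prod_XsubC _ _ (enum A)).
- by rewrite (monicP monP) scale1r big_enum.
- by rewrite szP cardE.
- by apply/allP => a; rewrite mem_enum => /rP.
- by rewrite uniq_rootsE enum_uniq.
Qed.

(** By the product rule, at a root [a] only the term that differentiates ['X - a%:P] survives; it
    leaves the product of the [a - b] over [b != a]. *)
Lemma prod_differences (F : finFieldType) (A : {set F}) :
  \prod_(u in [set u : F * F | [&& u.1 \in A, u.2 \in A & u.1 != u.2]])
     (u.1 - u.2)
  = \prod_(a in A) (\prod_(b in A) ('X - b%:P))^`().[a].
Proof.
rewrite (eq_bigl (fun u => (u.1 \in A) && ((u.2 \in A) && (u.2 != u.1)))); last first.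
  by move=> u; rewrite inE eq_sym.
rewrite -(pair_big_dep (mem A) (fun a b => (b \in A) && (b != a))
           (fun a b => a - b)) /=.
apply: eq_bigr => a aA.
rewrite [in RHS](bigD1 a) //= derivM derivXsubC mul1r hornerD hornerM hornerXsubC.
rewrite subrr mul0r addr0 horner_prod.
by apply: eq_bigr => b _; rewrite hornerXsubC.
Qed.

Section QuadraticResidues.

Variable p : nat.
Hypotheses (p_prime : prime p) (p_gt2 : (2 < p)%N).

Lemma natr_Fp_eq0 m : (m%:R == 0 :> 'F_p) = (p %| m)%N.
Proof. by rewrite (dvdn_pcharf (pchar_Fp p_prime)). Qed.

Lemma fermat_Fp (x : 'F_p) : x != 0 -> x ^+ p.-1 = 1.
Proof.
move=> x0; apply: (mulfI x0); rewrite mulr1 -exprS prednK ?prime_gt0 //.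
by have := expf_card x; rewrite card_Fp.
Qed.

(** Squaring maps the nonzero elements onto the residues, with fibres [y], [- y] of two elements
    because [p] is odd. *)
Lemma card_quad_res : #|quad_res p|.*2 = p.-1.
Proof.
transitivity #|[set~ (0 : 'F_p)]|; last by rewrite cardsC1 card_Fp.
rewrite -[RHS]sum1_card (partition_big (fun y => y ^+ 2) (mem (quad_res p))) /=; last first.
  move=> y; rewrite !inE => y0; rewrite expf_neq0 //=.
  by apply/existsP; exists y.
rewrite -muln2 -sum_nat_const; apply: eq_bigr => s.
rewrite inE => /andP[s0 /existsP[y /eqP ys]].
have y0 : y != 0 by apply: contraNneq s0 => y0; rewrite -ys y0 expr0n.
have yNy : y != - y.
  rewrite -subr_eq0 opprK -mulr2n -mulr_natr mulf_neq0 //.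
  by rewrite natr_Fp_eq0 gtnNdvd.
(* The 2 becomes [(y != - y).+1], the form in which [cards2] counts [[set y; - y]]. *)
rewrite sum1dep_card -[LHS]/(true.+1) -yNy -cards2.
apply: eq_card => z; rewrite !inE -ys eqf_sqr.
by case: eqVneq => [->|_] /=; rewrite ?y0 //; case: eqVneq => [->|_];
  rewrite ?oppr_eq0 ?y0 ?andbF.
Qed.

Lemma euler_quad_res (s : 'F_p) : s \in quad_res p -> s ^+ #|quad_res p| = 1.
Proof.
rewrite inE => /andP[s0 /existsP[y /eqP ys]].
rewrite -ys -exprM mul2n card_quad_res fermat_Fp //.
by apply: contraNneq s0 => y0; rewrite -ys y0 expr0n.
Qed.

(** With r the number of residues, these are the roots of X^r - 1; evaluating the factorization at 0
    gives -1 = (-1)^r times the product. *)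
Lemma prod_quad_res : ~~ odd #|quad_res p| ->
  \prod_(s in quad_res p) s = -1 :> 'F_p.
Proof.
move=> Re; have R0 : (0 < #|quad_res p|)%N.
  by rewrite -double_gt0 card_quad_res -ltnS prednK ?prime_gt0 ?(ltnW p_gt2).
have rootR : {in quad_res p, forall s, root ('X^(#|quad_res p|) - 1%:P) s}.
  by move=> s sR; rewrite rootE !hornerE euler_quad_res ?subrr.
have /(congr1 (horner^~ 0)) :=
  monic_prod_roots _ _ _ (monicXnsubC _ R0) (size_XnsubC _ R0) rootR.
rewrite !hornerE horner_prod expr0n eqn0Ngt R0 sub0r => ->.
rewrite [RHS](eq_bigr (fun s => - s)) => [|s _]; last by rewrite hornerXsubC sub0r.
by rewrite prodrN -signr_odd (negbTE Re) expr0 mul1r.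
Qed.

End QuadraticResidues.

Section CosetWithZero.

Variables (p : nat) (g : {unit 'F_p}) (H : {group {unit 'F_p}}).

Lemma unit_Fp_neq0 (u : {unit 'F_p}) : val u != 0.
Proof. by rewrite -unitfE; apply: valP. Qed.

Lemma cosetA_P (a : 'F_p) :
  reflect (a = 0 \/ exists2 h, h \in H & a = val g * val h) (a \in cosetA g H).
Proof.
rewrite !inE; apply: (iffP orP) => [[/eqP->|/imsetP[h hH ->]]|[->|[h hH ->]]].
- by left.
- by right; exists h; rewrite ?FinRing.val_unitM.
- by left.
- by right; apply/imsetP; exists h; rewrite ?FinRing.val_unitM.
Qed.

Lemma zero_notin_coset : (0 : 'F_p) \notin [set val (g * h)%g | h in H].
Proof.
by apply/imsetP => -[h _ /esym h0]; have := unit_Fp_neq0 (g * h)%g; rewrite h0 eqxx.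
Qed.

Lemma card_cosetA : #|cosetA g H| = #|H|.+1.
Proof.
rewrite cardsU1 card_imset; last first.
  by move=> h k /val_inj /mulgI.
by rewrite zero_notin_coset.
Qed.

Lemma expr_card_unit (h : {unit 'F_p}) : h \in H -> val h ^+ #|H| = 1.
Proof. by move=> hH; rewrite -FinRing.val_unitX expg_cardG. Qed.

Lemma prod_cosetA :
  \prod_(a in cosetA g H) ('X - a%:P)
  = 'X^(#|H|.+1) - (val g ^+ #|H|) *: 'X :> {poly 'F_p}.
Proof.
have szX : (size (- (val g ^+ #|H| *: 'X) : {poly 'F_p})
              < size ('X^(#|H|.+1) : {poly 'F_p}))%N.
  rewrite size_polyN size_polyXn (leq_ltn_trans (size_scale_leq _ _)) //.
  by rewrite size_polyX !ltnS cardG_gt0.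
apply/esym/monic_prod_roots.
- by rewrite monicE lead_coefDl // lead_coefXn.
- by rewrite size_polyDl // size_polyXn card_cosetA.
move=> a /cosetA_P[->|[h hH ->]]; rewrite rootE hornerD hornerN hornerZ hornerX hornerXn.
  by rewrite expr0n mulr0 subr0.
by rewrite exprSr exprMn (expr_card_unit _ hH) mulr1 subrr.
Qed.

(** The point g x is a root of the polynomial in [prod_cosetA], so one of its linear factors
    vanishes there. Hence every n-th root of unity comes from [H], where n = [#|H|]. *)
Lemma mem_cosetA (x : 'F_p) : x ^+ #|H| = 1 -> val g * x \in cosetA g H.
Proof.
move=> xH; have /(congr1 (horner^~ (val g * x))) := prod_cosetA.
rewrite hornerD hornerN hornerZ hornerX hornerXn horner_prod.
rewrite exprSr exprMn xH mulr1 subrr => /eqP/prodf_eq0[a aA].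
by rewrite hornerXsubC subr_eq0 => /eqP ->.
Qed.

(** With n = [#|H|], the derivative (n+1)X^n - g^n takes the value -g^n at 0, as n > 0, and n g^n at
    each of the n points of gH. *)
Lemma prod_deriv_cosetA :
  \prod_(a in cosetA g H) (\prod_(b in cosetA g H) ('X - b%:P))^`().[a]
  = - (#|H|%:R ^+ #|H| * val g ^+ (#|H| * #|H|.+1)).
Proof.
rewrite prod_cosetA derivB derivXn derivZ derivX succnK.
rewrite big_setU1; last exact: zero_notin_coset.
rewrite big_imset; last by move=> h k _ _ /val_inj /mulgI.
rewrite [in LHS](eq_bigr (fun=> #|H|%:R * val g ^+ #|H|)) => [|h hH]; last first.
  rewrite hornerD hornerN hornerMn hornerXn hornerZ hornerC mulr1.
  rewrite FinRing.val_unitM exprMn (expr_card_unit _ hH) mulr1.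
  by rewrite mulrSr addrK mulr_natl.
rewrite prodr_const hornerD hornerN hornerMn hornerXn hornerZ hornerC mulr1.
rewrite expr0n eqn0Ngt cardG_gt0 mul0rn sub0r exprMn -exprM.
by rewrite -[LHS]/(GRing.mul _ _) mulNr mulrCA -exprD -mulnS.
Qed.

End CosetWithZero.

Section ExactDifferences.

Variables (G : finZmodType) (A S : {set G}).
Hypotheses (A_diff : diff_exact A S) (S_neq0 : 0 \notin S).

Let D := [set u : G * G | [&& u.1 \in A, u.2 \in A & u.1 != u.2]].

(** As [a != b], the common difference lies in [S], where representations are unique. *)
Lemma diff_exact_inj (a b c d : G) : a \in A -> b \in A -> c \in A -> d \in A ->
  a != b -> a - b = c - d -> (a, b) = (c, d).
Proof.
move=> aA bA cA dA ab E.
have [u [_ uniq_u]] := A_diff.1 _ (A_diff.2 _ _ aA bA ab).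
by rewrite -(uniq_u (a, b)) ?(uniq_u (c, d)).
Qed.

Lemma diff_exact_injD : {in D &, injective (fun u => u.1 - u.2)}.
Proof.
move=> [a b] [c d]; rewrite !inE /= => /and3P[aA bA ab] /and3P[cA dA _].
exact: diff_exact_inj.
Qed.

Lemma diff_exact_imset : S = [set u.1 - u.2 | u in D].
Proof.
apply/setP => s; apply/idP/imsetP => [sS|[[a b]]].
  have [[a b] [[/= aA bA sE] _]] := A_diff.1 s sS.
  exists (a, b) => //; rewrite inE aA bA /=.
  (* A representation with equal entries would put 0 in [S]. *)
  by apply: contraNneq S_neq0 => ab; rewrite -(subrr b) -{1}ab sE.
by rewrite inE => /and3P[aA bA ab] ->; apply: A_diff.2.
Qed.

Lemma card_diff_exact : #|S| = (#|A| * #|A|.-1)%N.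
Proof.
rewrite diff_exact_imset card_in_imset; last exact: diff_exact_injD.
rewrite -sum1_card (eq_bigl (fun u => (u.1 \in A) && (u.2 \in A :\ u.1))); last first.
  by move=> u; rewrite !inE eq_sym; case: (u.1 \in A); rewrite //= andbC.
rewrite -(pair_big_dep (mem A) (fun a b => b \in A :\ a) (fun _ _ => 1%N)) /=.
rewrite -sum_nat_const; apply: eq_bigr => a aA.
by rewrite sum1_card [in RHS](cardsD1 a) aA.
Qed.

End ExactDifferences.

Theorem theorem2 (p : nat) (hp : prime p) (hp5 : (5 < p)%N) :
  ~ exists (H : {group {unit 'F_p}}) (g : {unit 'F_p}),
      diff_exact (cosetA g H) (quad_res p).
Proof.
move=> [H [g A_diff]].
have p_gt2 : (2 < p)%N by apply: ltn_trans hp5.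
have S_neq0 : 0 \notin quad_res p by rewrite inE eqxx.
have card_R : #|quad_res p| = (#|H| * #|H|.+1)%N.
  by rewrite (card_diff_exact _ _ _ A_diff S_neq0) card_cosetA mulnC.
have pE : p = ((#|H| * #|H|.+1).*2).+1.
  by rewrite -card_R card_quad_res // prednK ?prime_gt0.
have memA x : x ^+ #|H| = 1 -> val g * x \in cosetA g H by apply: mem_cosetA.
have gA : val g * 1 \in cosetA g H by apply: memA; rewrite expr1n.
have zA : 0 \in cosetA g H by apply/cosetA_P; left.
have g0 := unit_Fp_neq0 _ g.
(* g = g - 0 is a difference of elements of A; Euler's criterion will then remove the power of g
   from the product. *)
have gR : val g \in quad_res p.
  have := A_diff.2 _ _ gA zA; rewrite mulr1 subr0; exact.
pose n : 'F_p := #|H|%:R.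
have nn : n ^+ #|H| = 1.
  (* The number of residues, n(n+1), is even, so their product is -1. *)
  have := prod_quad_res _ hp p_gt2; rewrite card_R oddM oddS andbN => /(_ isT).
  have -> : \prod_(s in quad_res p) s
      = \prod_(s in [set u.1 - u.2 | u in [set u : 'F_p * 'F_p |
          [&& u.1 \in cosetA g H, u.2 \in cosetA g H & u.1 != u.2]]]) s.
    by rewrite -(diff_exact_imset _ _ _ A_diff S_neq0).
  rewrite big_imset; last exact: diff_exact_injD A_diff.
  rewrite prod_differences prod_deriv_cosetA -card_R.
  by rewrite euler_quad_res // mulr1 => /oppr_inj.
have n_root : 2 * n * (n + 1) + 1 = 0.
  have <- : p%:R = 0 :> 'F_p by apply/eqP; rewrite natr_Fp_eq0.
  have -> := congr1 (fun k => k%:R : 'F_p) pE.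
  by rewrite -[RHS]natr1 -muln2 !natrM -[#|H|.+1%:R]natr1 -/n -mulrA mulrC.
(* A trivial [H] would give p = 5. *)
have H_gt1 : (1 < #|H|)%N.
  rewrite ltn_neqAle cardG_gt0 andbT; apply: contraTneq hp5 => H1.
  by rewrite [X in (_ < X)%N]pE -H1.
(* Otherwise p would divide [#|H|] - 1, which lies strictly between 0 and p. *)
have n1 : n != 1.
  rewrite -subr_eq0 -(natrB _ (cardG_gt0 H)) natr_Fp_eq0 // gtnNdvd ?subn_gt0 //.
  rewrite [X in (_ < X)%N]pE ltnS -addnn (leq_trans (leq_subr _ _)) //.
  by rewrite (leq_trans _ (leq_addr _ _)) // leq_pmulr.
have cubeE : 2 * n ^+ 3 = n + 1.
  by apply/eqP; rewrite -subr_eq0 cubic_factor n_root mulr0.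
(* If n^3 = 1, then [cubeE] reads 2 = n + 1, so n = 1. *)
have n3 : n ^+ 3 != 1.
  apply: contraNneq n1 => n3; move: cubeE; rewrite n3 mulr1 => /eqP.
  by rewrite -[2]/(1 + 1) (inj_eq (addIr _)) eq_sym.
have gn3A : val g * n ^+ 3 \in cosetA g H.
  by apply: memA; rewrite exprAC nn expr1n.
(* Uniqueness identifies the two representations; their second entries give n^3 = 1, against
   [n3]. *)
have /(congr1 snd)/(mulfI g0)/esym/eqP : (val g * n ^+ 3, val g * 1) = (val g * n, val g * n ^+ 3).
  apply: (diff_exact_inj _ _ _ A_diff _ _ _ _ gn3A gA (memA _ nn) gn3A).
    by rewrite (inj_eq (mulfI g0)).
  (* After cancelling g, the equality n^3 - 1 = n - n^3 is [cubeE]. *)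
  rewrite -!mulrBr; congr (_ * _); apply/eqP.
  by rewrite subr_eq addrAC eq_sym subr_eq -cubeE mulr2n mulrDl mul1r.
exact/negP.
Qed.
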